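(* Let $D$ be a right invariant split type distance on $S_\infty$ and let $R>0$. Suppose there exists an integer $N(R)$ such that $m(\sigma)-q(\sigma)\le N(R)$ for every split type $\sigma$ with $D(\sigma)\le R$. Then there exists a polynomial $P$ of degree at most $N(R)$ such that $V_{D,n}(R)=P(n)$ for all $n\ge N(R)$.
   Context: For $n\ge1$, $S_n$ is the group of permutations of $[n]=\{1,\dots,n\}$, in one-line notation. $S_\infty$ is the group of permutations of $\{1,2,\dots\}$ fixing all but finitely many entries; $S_n$ is identified with the subgroup of $S_\infty$ fixing every entry $>n$. For $\pi\in S_a$, $\tau\in S_b$, the concatenation is $\pi+\tau=(\pi(1)\ldots\pi(a)\,(a+\tau(1))\ldots(a+\tau(b)))\in S_{a+b}$. A permutation is connected if it is not a concatenation $\pi+\tau$ with $\pi\in S_a,\tau\in S_b$, $a,b\ge1$; each permutation in $S_n$ is uniquely a concatenation of connected permutations (split decomposition). The split type of a permutation is the concatenation, in order, of the parts of its split decomposition different from the trivial permutation $(1)\in S_1$. A split type is a permutation $\sigma\in S_m$ all of whose split-decomposition parts are nontrivial; $m(\sigma)$ is the unique $m$ such that $\sigma\in S_m$ is a split type, and $q(\sigma)$ is the number of parts of its split decomposition. A metric $D$ on $S_\infty$ is right invariant if $D(uw,vw)=D(u,v)$ for all $u,v,w\in S_\infty$; write $D(u)=D(\mathrm{id},u)$. $D$ is a split type distance if $D(u)=D(v)$ whenever $u$ and $v$ have the same split type. $V_{D,n}(R)=\#\{u\in S_n: D(u)\le R\}$. *)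

(* Defs.v *)
From HB Require Import structures.
From mathcomp Require Import all_boot all_order all_algebra all_fingroup.
From mathcomp Require Import finmap reals.

Set Implicit Arguments.
Unset Strict Implicit.
Unset Printing Implicit Defensive.

Import Order.TTheory GRing.Theory Num.Theory.

(* [n] = {1, ..., n} is modelled by 'I_n and {1, 2, ...} by nat, entry i + 1  *)
(* being represented by i.                                                    *)

(* S_oo: the injective functions nat -> nat that differ from the identity at  *)
(* finitely many points only; like the elements of {perm T}, these are        *)
(* automatically bijective (see perm_inf_mulV).                             *)
Record perm_inf := PermInf {
  perm_inf_val :> {fsfun nat -> nat of x => x};
  _ : fsinjectiveb perm_inf_val }.

HB.instance Definition _ := [isSub for perm_inf_val].
HB.instance Definition _ := [Choice of perm_inf by <:].

Section PermInfGroup.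

Lemma perm_inf_inj (u : perm_inf) : injective u.
Proof. exact/fsinjectiveP/(valP u). Qed.

Lemma perm_infP (u v : perm_inf) : u =1 v <-> u = v.
Proof.
split=> [uv|-> //]; apply: val_inj; exact/fsfunP.
Qed.

Fact perm_inf_one_subproof : fsinjectiveb [fsfun for (fun x : nat => x)].
Proof. by apply/fsinjectiveP => x y; rewrite !fsfun0E. Qed.
Definition perm_inf_one := PermInf perm_inf_one_subproof.

(* (u * v) x = u (v x); this is opposite to the convention of {perm T}.       *)
Fact perm_inf_mul_subproof (u v : perm_inf) :
  fsinjectiveb (fsfun_comp (val u) (val v)).
Proof.
by apply/fsinjectiveP/fscomp_inj; exact: perm_inf_inj.
Qed.
Definition perm_inf_mul (u v : perm_inf) := PermInf (perm_inf_mul_subproof u v).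

Lemma perm_inf_mulE (u v : perm_inf) x : perm_inf_mul u v x = u (v x).
Proof. exact: fscompE. Qed.

Fact perm_inf_surj (u : perm_inf) y : exists x, u x == y.
Proof.
have [ys|ys] := boolP (y \in finsupp u); last first.
  by exists y; rewrite fsfun_dflt.
have /imfset_eq_fsinjectiveP e := valP u.
by move: ys; rewrite -[X in _ \in X]e => /imfsetP[x _ ->]; exists x.
Qed.

Definition perm_inf_inv_fun (u : perm_inf) y := xchoose (perm_inf_surj u y).

Lemma perm_inf_inv_funK (u : perm_inf) : cancel (perm_inf_inv_fun u) u.
Proof. by move=> y; apply/eqP/(xchooseP (perm_inf_surj u y)). Qed.

Definition perm_inf_inv_val (u : perm_inf) : {fsfun nat -> nat of x => x} :=
  [fsfun y in finsupp u => perm_inf_inv_fun u y].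

Lemma perm_inf_inv_valE (u : perm_inf) y :
  perm_inf_inv_val u y = perm_inf_inv_fun u y.
Proof.
rewrite fsfunE; case: ifPn => // ys.
by apply: (@perm_inf_inj u); rewrite perm_inf_inv_funK fsfun_dflt.
Qed.

Fact perm_inf_inv_subproof (u : perm_inf) : fsinjectiveb (perm_inf_inv_val u).
Proof.
apply/fsinjectiveP => x y; rewrite !perm_inf_inv_valE.
exact: (can_inj (@perm_inf_inv_funK u)).
Qed.
Definition perm_inf_inv (u : perm_inf) := PermInf (perm_inf_inv_subproof u).

Fact perm_inf_mulA : associative perm_inf_mul.
Proof. by move=> u v w; apply/perm_infP => x; rewrite !perm_inf_mulE. Qed.

Fact perm_inf_mul1 : left_id perm_inf_one perm_inf_mul.
Proof. by move=> u; apply/perm_infP => x; rewrite perm_inf_mulE fsfun0E. Qed.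

Fact perm_inf_mulr1 : right_id perm_inf_one perm_inf_mul.
Proof. by move=> u; apply/perm_infP => x; rewrite perm_inf_mulE fsfun0E. Qed.

Fact perm_inf_mulV : right_inverse perm_inf_one perm_inf_inv perm_inf_mul.
Proof.
move=> u; apply/perm_infP => x.
by rewrite perm_inf_mulE perm_inf_inv_valE perm_inf_inv_funK fsfun0E.
Qed.

Fact perm_inf_mulVl : left_inverse perm_inf_one perm_inf_inv perm_inf_mul.
Proof.
move=> u; apply/perm_infP => x; apply: (@perm_inf_inj u).
by rewrite perm_inf_mulE perm_inf_inv_valE perm_inf_inv_funK fsfun0E.
Qed.

End PermInfGroup.

HB.instance Definition _ := isGroup.Build perm_inf
  perm_inf_mulA perm_inf_mul1 perm_inf_mulr1 perm_inf_mulVl perm_inf_mulV.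

Local Open Scope group_scope.

Definition perm_ext n (p : 'S_n) (x : nat) : nat :=
  if insub x is Some i then val (p i) else x.

Lemma perm_ext_ord n (p : 'S_n) (i : 'I_n) : perm_ext p i = p i.
Proof. by rewrite /perm_ext valK. Qed.

Lemma perm_ext_ge n (p : 'S_n) x : (n <= x)%N -> perm_ext p x = x.
Proof. by move=> nx; rewrite /perm_ext insubN // -leqNgt. Qed.

Lemma perm_extK n (p : 'S_n) : cancel (perm_ext p) (perm_ext p^-1).
Proof.
move=> x; have [nx|xn] := leqP n x; first by rewrite !perm_ext_ge.
by rewrite -[x]/(val (Ordinal xn)) !perm_ext_ord permK.
Qed.

Definition perm_incl_val n (p : 'S_n) : {fsfun nat -> nat of x => x} :=
  [fsfun x in [fset y in iota 0 n]%fset => perm_ext p x].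

Lemma perm_incl_valE n (p : 'S_n) x : perm_incl_val p x = perm_ext p x.
Proof.
rewrite fsfunE !inE mem_iota /=; case: ltnP => // nx.
by rewrite perm_ext_ge.
Qed.

Fact perm_incl_subproof n (p : 'S_n) : fsinjectiveb (perm_incl_val p).
Proof.
apply/fsinjectiveP => x y; rewrite !perm_incl_valE.
exact: (can_inj (@perm_extK n p)).
Qed.

(* The inclusion of S_n in S_oo *)
Definition perm_incl n (p : 'S_n) : perm_inf := PermInf (perm_incl_subproof p).

Lemma perm_incl_ord n (p : 'S_n) (i : 'I_n) : perm_incl p i = p i.
Proof. by rewrite [LHS]perm_incl_valE perm_ext_ord. Qed.

Lemma perm_incl_ge n (p : 'S_n) x : (n <= x)%N -> perm_incl p x = x.
Proof. by move=> nx; rewrite [LHS]perm_incl_valE perm_ext_ge. Qed.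

Definition concat_fun a b (f : 'I_a -> 'I_a) (g : 'I_b -> 'I_b)
    (i : 'I_(a + b)) : 'I_(a + b) :=
  match split i with
  | inl j => lshift b (f j)
  | inr k => rshift a (g k)
  end.

Fact concat_fun_inj a b (p : 'S_a) (t : 'S_b) : injective (concat_fun p t).
Proof.
apply: (can_inj (g := concat_fun p^-1 t^-1)) => i; rewrite /concat_fun.
case: (split_ordP i) => [j ->|k ->].
  by rewrite (unsplitK (inl _)) permK.
by rewrite (unsplitK (inr _)) permK.
Qed.

Definition concat a b (p : 'S_a) (t : 'S_b) : 'S_(a + b) :=
  perm (@concat_fun_inj a b p t).

Lemma concat_lshift a b (p : 'S_a) (t : 'S_b) j :
  concat p t (lshift b j) = lshift b (p j).
Proof. by rewrite permE /concat_fun (unsplitK (inl _)). Qed.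

Lemma concat_rshift a b (p : 'S_a) (t : 'S_b) k :
  concat p t (rshift a k) = rshift a (t k).
Proof. by rewrite permE /concat_fun (unsplitK (inr _)). Qed.

(* Permutations of [n] for an unspecified n, so that permutations of          *)
(* different sizes can be compared and put in a list; the empty permutation   *)
(* (n = 0) is the concatenation of the empty list.                            *)
Definition fperm := {n : nat & 'S_n}.

Definition fconcat (s t : fperm) : fperm :=
  Tagged (fun n => 'S_n) (concat (tagged s) (tagged t)).

Definition fperm0 : fperm := Tagged (fun n => 'S_n) (1 : 'S_0).
Definition fperm1 : fperm := Tagged (fun n => 'S_n) (1 : 'S_1).

Definition fperm_incl (s : fperm) : perm_inf := perm_incl (tagged s).

Definition fconcat_seq (l : seq fperm) : fperm := foldr fconcat fperm0 l.

Definition connected (s : fperm) : Prop :=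
  (1 <= tag s)%N /\
  forall a b : fperm, (1 <= tag a)%N -> (1 <= tag b)%N -> s <> fconcat a b.

Definition split_decomposition (s : fperm) (l : seq fperm) : Prop :=
  {in l, forall c, connected c} /\ s = fconcat_seq l.

(* split_type u t <-> t is the split type of u; the split type of the         *)
(* identity is the empty permutation.                                         *)
Definition split_type (u : perm_inf) (t : fperm) : Prop :=
  exists (s : fperm) (l : seq fperm),
    [/\ u = fperm_incl s, split_decomposition s l
      & t = fconcat_seq [seq c <- l | c != fperm1]].

Local Close Scope group_scope.
Local Open Scope ring_scope.

Section Distances.
Variable R : realType.
Implicit Type D : perm_inf -> perm_inf -> R.

Definition is_metric D : Prop :=
  [/\ forall u v, 0 <= D u v,
      forall u v, D u v = 0 <-> u = v,
      forall u v, D u v = D v u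
    & forall u v w, D u w <= D u v + D v w].

Definition right_invariant D : Prop :=
  forall u v w, D (u * w)%g (v * w)%g = D u v.

Definition split_type_distance D : Prop :=
  forall u v t, split_type u t -> split_type v t -> D 1%g u = D 1%g v.

Definition ball_card D (n : nat) (r : R) : nat :=
  #|[set u : 'S_n | D 1%g (perm_incl u) <= r]|.

End Distances.

(* Main.v *)
(* A permutation of [n] of split type t is a shuffle of the q parts of t with
   n - m trivial parts, where m is the size of t; there are 'C(n - (m - q), q)
   of them as soon as n >= m - q, and this is a polynomial in n of degree q.
   Membership in the ball depends on the split type only, so the ball is the
   disjoint union of these families over the split types t in the ball. Since
   nontrivial connected parts have size at least 2, the bound m - q <= N gives
   q <= N and m <= 2N: there are finitely many such t, and all the polynomials
   involved have degree at most N. *)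

Require Import Defs.
From HB Require Import structures.
From mathcomp Require Import all_boot all_order all_algebra all_fingroup.
From mathcomp Require Import finmap reals.
From mathcomp Require Import boolp zify.

Set Implicit Arguments.
Unset Strict Implicit.
Unset Printing Implicit Defensive.

Import Order.TTheory GRing.Theory Num.Theory.

Local Open Scope ring_scope.

Section SplitDecomposition.
Local Open Scope nat_scope.
Implicit Types (s t c : fperm) (l : seq fperm).

(** * Left factors and uniqueness of the split decomposition *)

Lemma perm_ext_lt n (p : 'S_n) x : x < n -> perm_ext p x < n.
Proof. by move=> xn; rewrite -[x]/(val (Ordinal xn)) perm_ext_ord. Qed.

(** Comparing extensions to [nat] avoids transport between ['S_n] and ['S_m] when the sizes are only
    provably equal. *)
Lemma fperm_eqP s t :
  tag s = tag t -> perm_ext (tagged s) =1 perm_ext (tagged t) -> s = t.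
Proof.
case: s t => [n p] [m q] /= enm; case: m / enm q => q epq.
congr (Tagged _ _); apply/permP => i; apply: val_inj.
by rewrite /= -!perm_ext_ord epq.
Qed.

Lemma perm_ext_fconcat s t x :
  perm_ext (tagged (fconcat s t)) x =
  if x < tag s then perm_ext (tagged s) x
  else tag s + perm_ext (tagged t) (x - tag s).
Proof.
case: s t => [a p] [b q] /=; case: ltnP => [xa|ax].
  rewrite -[x]/(val (lshift b (Ordinal xa))) perm_ext_ord concat_lshift.
  by rewrite -[X in _ = perm_ext _ X]/(val (Ordinal xa)) perm_ext_ord.
have [xab|abx] := ltnP x (a + b); last by rewrite !perm_ext_ge; lia.
have xb : x - a < b by lia.
have -> : x = val (rshift a (Ordinal xb)) by rewrite /=; lia.
rewrite perm_ext_ord concat_rshift /=.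
have -> : a + (x - a) - a = val (Ordinal xb) by rewrite /=; lia.
by rewrite perm_ext_ord.
Qed.

(** Below [tag s], [t] already takes every value below [tag s]; by injectivity it sends the
    remaining entries to values at least [tag s], and [c] is this remainder shifted down. *)
Lemma fconcat_factor s t : tag s <= tag t ->
  (forall x, x < tag s -> perm_ext (tagged t) x = perm_ext (tagged s) x) ->
  exists c, t = fconcat s c.
Proof.
case: s t => [a p] [b q] /= ab eqp.
have ge i : a <= i -> a <= perm_ext q i.
  move=> ai; rewrite leqNgt; apply/negP => lt.
  have lt' := perm_ext_lt p^-1%g lt.
  have := eqp _ lt'; have := perm_extK p^-1%g (perm_ext q i); rewrite invgK => ->.
  by move/(can_inj (perm_extK q)) => E; lia.
have hc (i : 'I_(b - a)) : perm_ext q (a + i) - a < b - a.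
  have := ge (a + i); have := @perm_ext_lt _ q (a + i); have := ltn_ord i; lia.
pose f i := Ordinal (hc i).
have f_inj : injective f.
  move=> i j [] E; apply: val_inj => /=; apply: (@addnI a).
  apply: (can_inj (perm_extK q)).
  by have := ge (a + i); have := ge (a + j); lia.
exists (Tagged (fun n => 'S_n) (perm f_inj)).
apply: fperm_eqP => [/=|x]; first by rewrite subnKC.
rewrite perm_ext_fconcat /=; case: ltnP => [|ax]; first exact: eqp.
have [xb|bx] := ltnP x b; last by rewrite !perm_ext_ge; lia.
have xba : x - a < b - a by lia.
rewrite -[x - a]/(val (Ordinal xba)) perm_ext_ord permE /=.
by rewrite !subnKC // ge.
Qed.

Lemma fconcat_inj s s' t t' :
  tag s = tag s' -> fconcat s t = fconcat s' t' -> s = s' /\ t = t'.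
Proof.
move=> es E.
have es' : s = s'.
  apply: fperm_eqP => // x; have [xs|sx] := ltnP x (tag s).
    have := perm_ext_fconcat s t x; rewrite xs => <-.
    have xs' : x < tag s' by rewrite -es.
    by rewrite E perm_ext_fconcat xs'.
  by rewrite !perm_ext_ge // -es.
split=> //; rewrite -{s' es}es' in E; apply: fperm_eqP => [|x].
  by move/(congr1 (@tag _ _)): E => /=; lia.
have := perm_ext_fconcat s t (tag s + x); rewrite E perm_ext_fconcat.
have -> : (tag s + x < tag s) = false by lia.
by rewrite addKn => /addnI.
Qed.

(* Otherwise s would be a proper left factor of s', contradicting its
   connectedness. *)
Lemma fconcat_connected_le s s' t t' : connected s -> connected s' ->
  fconcat s t = fconcat s' t' -> tag s' <= tag s.
Proof.
move=> [s1 _] [_ cs'] E; rewrite leqNgt; apply/negP => lt.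
have [x xs|c ec] := @fconcat_factor s s' (ltnW lt).
  have := perm_ext_fconcat s t x; rewrite xs => <-.
  by rewrite E perm_ext_fconcat (ltn_trans xs lt).
apply: (cs' s c) => //.
by move/(congr1 (@tag _ _)): ec => /=; lia.
Qed.

(** By [fconcat_connected_le] used in both directions, the first parts have equal size, so they
    coincide and can be cancelled. *)
Lemma fconcat_seq_inj l l' :
  {in l, forall c, connected c} -> {in l', forall c, connected c} ->
  fconcat_seq l = fconcat_seq l' -> l = l'.
Proof.
elim: l l' => [|c l IH] [|c' l'] //= cl cl'.
- have [c1 _] := cl' c' (mem_head _ _).
  by move/(congr1 (@tag _ _)) => /=; lia.
- have [c1 _] := cl c (mem_head _ _).
  by move/(congr1 (@tag _ _)) => /=; lia.
move=> E; have hc := cl c (mem_head _ _); have hc' := cl' c' (mem_head _ _).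
have ec : tag c = tag c'.
  apply/eqP; rewrite eqn_leq (fconcat_connected_le hc hc' E).
  by rewrite (fconcat_connected_le hc' hc (esym E)).
have [-> /IH ->] := fconcat_inj ec E; first by [].
- by move=> d dl; apply: cl; rewrite inE dl orbT.
- by move=> d dl; apply: cl'; rewrite inE dl orbT.
Qed.

(** * The concatenation monoid and existence of the split decomposition *)

Lemma fconcatA : associative fconcat.
Proof.
move=> s t c; apply: fperm_eqP => [/=|x]; first by rewrite addnA.
rewrite !perm_ext_fconcat /=.
have [xs|sx] := ltnP x (tag s); first by rewrite (ltn_addr _ xs).
have -> : (x - tag s < tag t) = (x < tag s + tag t) by lia.
by case: ifP => // _; rewrite subnDA addnA.
Qed.

Lemma fconcat0s : left_id fperm0 fconcat.
Proof.
move=> s; apply: fperm_eqP => // x.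
by rewrite perm_ext_fconcat subn0.
Qed.

Lemma fconcats0 : right_id fperm0 fconcat.
Proof.
move=> s; apply: fperm_eqP => [/=|x]; first by rewrite addn0.
rewrite perm_ext_fconcat; case: ltnP => // sx.
by rewrite perm_ext_ge // subnKC // perm_ext_ge.
Qed.

Lemma fconcat_seq_cat l l' :
  fconcat_seq (l ++ l') = fconcat (fconcat_seq l) (fconcat_seq l').
Proof.
by elim: l => [|c l IH] /=; rewrite ?fconcat0s // IH fconcatA.
Qed.

Lemma tag_fconcat_seq l : tag (fconcat_seq l) = sumn [seq tag c | c <- l].
Proof. by elim: l => //= c l ->. Qed.

Lemma fperm_tag0 s : tag s = 0 -> s = fperm0.
Proof.
move=> s0; apply: fperm_eqP => // x.
by rewrite !perm_ext_ge // s0.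
Qed.

Lemma fperm_tag1 s : tag s = 1 -> s = fperm1.
Proof.
case: s => n p /= n1; rewrite n1 in p *; congr (Tagged _ _).
by apply/permP => i; rewrite !ord1.
Qed.

(** Strong induction on the size: a nonempty permutation that is not connected is a concatenation of
    two strictly smaller ones. *)
Lemma split_decomposition_exists s : exists l, split_decomposition s l.
Proof.
have [n] := ubnP (tag s); elim: n s => // n IH s /ltnSE sn.
have [s0|s_gt0] := posnP (tag s); first by exists [::]; split=> //; exact: fperm_tag0.
have [cs|ncs] := EM (connected s).
  by exists [:: s]; split=> [c|]; rewrite ?inE /= ?fconcats0 // => /eqP ->.
have [a [b [a1 b1 E]]] : exists a b, [/\ 1 <= tag a, 1 <= tag b & s = fconcat a b].
  apply: contra_notP ncs => H; split=> // a b a1 b1 E.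
  by apply: H; exists a, b.
have tE : tag s = tag a + tag b by rewrite E.
have [la [ca ea]] := IH a ltac:(lia).
have [lb [cb eb]] := IH b ltac:(lia).
exists (la ++ lb); split; last by rewrite fconcat_seq_cat -ea -eb.
by move=> c; rewrite mem_cat => /orP[/ca|/cb].
Qed.

(** The list chosen by [cid] is the only possible one, by [fconcat_seq_inj]. *)
Definition split_parts s : seq fperm := projT1 (cid (split_decomposition_exists s)).

Lemma split_partsP s : split_decomposition s (split_parts s).
Proof. exact: projT2 (cid (split_decomposition_exists s)). Qed.

Lemma split_partsK : cancel split_parts fconcat_seq.
Proof. by move=> s; have [_ <-] := split_partsP s. Qed.

Lemma split_parts_connected s : {in split_parts s, forall c, connected c}.
Proof. by have [] := split_partsP s. Qed.

Lemma fconcat_seqK l : {in l, forall c, connected c} ->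
  split_parts (fconcat_seq l) = l.
Proof.
move=> cl; apply: fconcat_seq_inj => //; first exact: split_parts_connected.
exact: split_partsK.
Qed.

(** * Nontrivial parts and the insertion of trivial ones *)

Definition nontrivial_parts s : seq fperm :=
  [seq c <- split_parts s | c != fperm1].

Lemma nontrivial_parts_neq1 s : all (fun c => c != fperm1) (nontrivial_parts s).
Proof. exact: filter_all. Qed.

Lemma nontrivial_parts_connected s :
  {in nontrivial_parts s, forall c, connected c}.
Proof. by move=> c; rewrite mem_filter => /andP[_ /split_parts_connected]. Qed.

(** A split type is its own split type. It can therefore be handled as the list of its parts, from
    which both m and q are read off. *)
Lemma nontrivial_partsK s :
  nontrivial_parts (fconcat_seq (nontrivial_parts s)) = nontrivial_parts s.
Proof.
rewrite {1}/nontrivial_parts fconcat_seqK; last exact: nontrivial_parts_connected.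
exact/all_filterP/nontrivial_parts_neq1.
Qed.

Lemma split_type_incl s :
  split_type (fperm_incl s) (fconcat_seq (nontrivial_parts s)).
Proof. by exists s, (split_parts s); split=> //; exact: split_partsP. Qed.

Lemma connected_tag_gt1 c : connected c -> c != fperm1 -> 1 < tag c.
Proof.
move=> [c1 _]; apply: contraNltn => c_le1; apply/eqP/fperm_tag1; lia.
Qed.

Lemma double_size_le_tag l : {in l, forall c, connected c} ->
  all (fun c => c != fperm1) l -> (size l).*2 <= tag (fconcat_seq l).
Proof.
elim: l => //= c l IH cl /andP[c1 /IH l1].
have := connected_tag_gt1 (cl c (mem_head _ _)) c1.
have := l1 _; rewrite doubleS => h1 h2.
suff : (size l).*2 <= tag (fconcat_seq l) by lia.
by apply: h1 => d dl; apply: cl; rewrite inE dl orbT.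
Qed.

(** Deleting a trivial part lowers the size and the number of parts by one each, so their difference
    is invariant; the additive form avoids truncated subtraction. *)
Lemma tag_nontrivial_parts s :
  tag s + size (nontrivial_parts s) =
  tag (fconcat_seq (nontrivial_parts s)) + size (split_parts s).
Proof.
rewrite -{1}(split_partsK s) /nontrivial_parts.
elim: (split_parts s) => //= c l IH.
by case: eqVneq => [->|_] /=; lia.
Qed.

(* The lists of length L that restrict to t when the entries fperm1 are
   deleted. *)
Fixpoint insert_trivial (L : nat) (t : seq fperm) : seq (seq fperm) :=
  if L is L'.+1 then
    [seq fperm1 :: l | l <- insert_trivial L' t] ++
    (if t is c :: t' then [seq c :: l | l <- insert_trivial L' t'] else [::])
  else if t is [::] then [:: [::]] else [::].

(** The two blocks in the definition of [insert_trivial] follow Pascal's rule. *)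
Lemma size_insert_trivial L l : size (insert_trivial L l) = 'C(L, size l).
Proof.
by elim: L l => [|L IH] [|c l] //=; rewrite size_cat ?size_map ?IH ?bin0.
Qed.

Lemma mem_insert_trivial L (t : seq fperm) l : all (fun c => c != fperm1) t ->
  (l \in insert_trivial L t) =
  (size l == L) && ([seq c <- l | c != fperm1] == t).
Proof.
have consI (c : fperm) : injective (cons c) by move=> ? ? [].
elim: L t l => [|L IH] t l tn1; first by case: t l tn1 => [|c t] [|d l].
have consF (c : fperm) ls : ([::] \in [seq c :: k | k <- ls]) = false.
  by apply/negbTE/negP => /mapP[].
have consN (c d : fperm) k ls : d != c -> (d :: k \in [seq c :: l' | l' <- ls]) = false.
  by move=> /eqP dc; apply/negbTE/negP => /mapP[? _ []].
rewrite /= mem_cat; case: l => [|d l].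
  by rewrite consF; case: t tn1 => //= c t _; rewrite consF.
have [->|dn1] := eqVneq d fperm1.
  rewrite mem_map // IH //= eqxx /= eqSS.
  case: t tn1 => [_|c t /= /andP[cn1 _]]; first by rewrite orbF.
  by rewrite eq_sym in cn1; rewrite consN // orbF.
rewrite consN //= dn1 /= eqSS.
case: t tn1 => [_|c t /= /andP[cn1 tn1]]; first by rewrite andbF.
rewrite eqseq_cons; have [->|dc] := eqVneq d c.
  by rewrite mem_map // IH.
by rewrite consN //= andbF.
Qed.

(** The two blocks are disjoint, their lists starting with [fperm1] and with [c != fperm1]
    respectively. *)
Lemma insert_trivial_uniq L (t : seq fperm) : all (fun c => c != fperm1) t ->
  uniq (insert_trivial L t).
Proof.
have consI (c : fperm) : injective (cons c) by move=> ? ? [].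
elim: L t => [|L IH] [|c t] //= => [_|/andP[cn1 tn1]].
  by rewrite cats0 map_inj_uniq ?IH.
rewrite cat_uniq !map_inj_uniq ?IH //= ?cn1 // andbT.
apply/hasPn => l /mapP[k _ ->]; apply/negP => /mapP[k' _ []] /eqP.
by rewrite (negbTE cn1).
Qed.

(** * Counting permutations of a given split type *)

Definition perm_parts n (p : 'S_n) := split_parts (Tagged (fun n => 'S_n) p).
Definition perm_type n (p : 'S_n) := nontrivial_parts (Tagged (fun n => 'S_n) p).

Lemma perm_parts_inj n : injective (@perm_parts n).
Proof.
move=> p q /(can_inj split_partsK) /eqP; rewrite eq_Tagged.
exact: eqP.
Qed.

(** [perm_parts] is a bijection from these permutations onto the lists in [insert_trivial L t] with
    L = n - (m - q), the total number of parts. *)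
Lemma card_perm_type n (t : seq fperm) : {in t, forall c, connected c} ->
  all (fun c => c != fperm1) t -> tag (fconcat_seq t) - size t <= n ->
  #|[set p : 'S_n | perm_type p == t]| =
  'C(n - (tag (fconcat_seq t) - size t), size t).
Proof.
move=> ct tn1 le_n; rewrite -size_insert_trivial.
have := double_size_le_tag ct tn1; set m := tag _ in le_n * => le_m.
rewrite cardE -(size_map (@perm_parts n)); apply/perm_size/uniq_perm.
- by rewrite map_inj_uniq ?enum_uniq //; exact: perm_parts_inj.
- exact: insert_trivial_uniq.
move=> l; rewrite mem_insert_trivial //; apply/mapP/andP => [[p]|[/eqP sz /eqP fl]].
  rewrite mem_enum inE => /eqP pt ->; split; last exact/eqP.
  have := tag_nontrivial_parts (Tagged (fun n => 'S_n) p).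
  by rewrite -[nontrivial_parts _]/(perm_type p) pt -/m /perm_parts /=; lia.
(* An entry of [l] is either [fperm1], too small to split, or kept by the filter and thus a member
   of [t]. *)
have cl : {in l, forall c, connected c}.
  move=> c cl; have [->|cn1] := eqVneq c fperm1; last first.
    by apply: ct; rewrite -fl mem_filter cn1.
  by split=> // a b a1 b1 /(congr1 (@tag _ _)) /=; lia.
have := tag_nontrivial_parts (fconcat_seq l).
have := fconcat_seqK cl; rewrite /nontrivial_parts => E; rewrite E fl -/m sz.
case: (fconcat_seq l) E => k p /= E kE.
(* Here k + q = m + (n - (m - q)), and [le_n] ensures that the outer subtraction does not
   truncate. *)
have ekn : k = n by lia.
case: n / ekn {le_n sz kE}; exists p => //.
by rewrite mem_enum inE /perm_type /nontrivial_parts E fl.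
Qed.

End SplitDecomposition.

(** * Binomial coefficients as polynomials *)

Lemma natr_bin (F : numFieldType) (k q : nat) :
  ('C(k, q))%:R = (q`!%:R)^-1 * \prod_(i < q) (k%:R - i%:R) :> F.
Proof.
have q_neq0 : q`!%:R != 0 :> F by rewrite pnatr_eq0 -lt0n fact_gt0.
apply: (mulfI q_neq0); rewrite mulVKf // -natrM mulnC bin_ffact.
elim: q {q_neq0} => [|q IH]; first by rewrite ffactn0 big_ord0.
rewrite ffactnSr natrM IH big_ord_recr /=; have [qk|kq] := leqP q k.
  by rewrite natrB.
(* For k < q the truncated k - q differs from the ring difference, but the factor of index k already
   makes both products vanish. *)
by rewrite (bigD1 (Ordinal kq)) //= subrr !mul0r.
Qed.

(* The polynomial takes the value 'C(n - d, q) at n only for n >= d, since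
   n - d is truncated. *)
Definition bin_poly (d q : nat) : {poly rat} :=
  (q`!%:R)^-1 *: \prod_(i < q) ('X - (d + i)%:R%:P).

Lemma size_bin_poly d q : (size (bin_poly d q) <= q.+1)%N.
Proof.
rewrite (leq_trans (size_scale_leq _ _)) //.
by rewrite size_prod_XsubC [index_enum _]unlock -enumT size_enum_ord.
Qed.

Lemma horner_bin_poly d q n : (d <= n)%N ->
  (bin_poly d q).[n%:R] = ('C(n - d, q))%:R.
Proof.
move=> dn; rewrite hornerZ horner_prod natr_bin; congr (_ * _).
by apply: eq_bigr => i _; rewrite hornerXsubC natrB // natrD opprD addrA.
Qed.

(** * Counting the ball by split types *)

Theorem theorem3p1 (R : realType) (D : perm_inf -> perm_inf -> R)
    (metricD : is_metric D) (invD : right_invariant D)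
    (splitD : split_type_distance D) (r : R) (r_gt0 : 0 < r) (N : int)
    (boundN : forall (s : fperm) (l : seq fperm),
       split_decomposition s l -> all (fun c => c != fperm1) l ->
       D 1%g (fperm_incl s) <= r -> (tag s)%:Z - (size l)%:Z <= N) :
  exists P : {poly rat},
    (size P)%:Z <= N + 1 /\
    forall n : nat, (1 <= n)%N -> N <= n%:Z -> P.[n%:R] = (ball_card D n r)%:R.
Proof.
(* The empty split type, that of the identity, lies in the ball and has m - q = 0. *)
have N_ge0 : 0 <= N.
  apply: (boundN fperm0 [::]) => //.
  have -> : fperm_incl fperm0 = 1%g.
    by apply/perm_infP => x; rewrite [LHS]perm_incl_ge // [RHS]fsfun0E.
  by have [_ D0 _ _] := metricD; rewrite (D0 1%g 1%g).2 // ltW.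
case: N N_ge0 boundN => // N _ boundN.
pose incl t := fperm_incl (fconcat_seq t).
pose small t := D 1%g (incl t) <= r.
have D_type s : D 1%g (fperm_incl s) = D 1%g (incl (nontrivial_parts s)).
  apply: splitD (split_type_incl s) _.
  have := split_type_incl (fconcat_seq (nontrivial_parts s)).
  by rewrite nontrivial_partsK.
have size_type s (t := nontrivial_parts s) : small t ->
    (tag (fconcat_seq t) - size t <= N)%N /\ (size t <= N)%N.
  have ct := @nontrivial_parts_connected s; have t1 := nontrivial_parts_neq1 s.
  move=> /(boundN _ _ (conj ct erefl) t1); have := double_size_le_tag ct t1.
  rewrite -/t; lia.
(* As m = (m - q) + q <= 2N, sizes up to 2N suffice; [undup] is there because many permutations
   share a type. *)
pose types := undup [seq t <- flatten
  [seq [seq perm_type p | p <- enum 'S_m] | m <- iota 0 N.*2.+1] | small t].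
have typesP t : t \in types -> small t /\ exists s, t = nontrivial_parts s.
  rewrite mem_undup mem_filter => /andP[-> /flattenP[ts /mapP[m _ ->]]].
  by move=> /mapP[p _ ->]; split=> //; exists (Tagged (fun n => 'S_n) p).
have typesI s : small (nontrivial_parts s) -> nontrivial_parts s \in types.
  move=> sm; rewrite mem_undup mem_filter sm; apply/flattenP.
  set t := fconcat_seq (nontrivial_parts s).
  exists [seq perm_type p | p <- enum 'S_(tag t)].
    apply/mapP; exists (tag t) => //; rewrite mem_iota.
    by have [] := size_type s sm; rewrite -/t; lia.
  (* The split type itself, seen as a permutation, realises its own list of parts. *)
  apply/mapP; exists (tagged t); first by rewrite mem_enum.
  by rewrite /perm_type taggedK nontrivial_partsK.
pose excess t := (tag (fconcat_seq t) - size t)%N.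
pose P : {poly rat} := \sum_(t <- types) bin_poly (excess t) (size t).
exists P; split.
  suff : (size P <= N.+1)%N by lia.
  rewrite /P big_seq; apply: (leq_trans (size_sum _ _ _)).
  apply/bigmax_leqP_seq => t _ /typesP[sm [s ts]]; subst t.
  have [_ le_N] := size_type s sm.
  exact: leq_trans (size_bin_poly _ _) _.
move=> n _; rewrite lez_nat => le_Nn; rewrite /P horner_sum /ball_card.
pose near (p : 'S_n) := D 1%g (perm_incl p) <= r.
have near_type p : near p = small (perm_type p).
  by rewrite /near (D_type (Tagged (fun n => 'S_n) p)).
(* All permutations of type [t] are in the ball as soon as [t] is, so restricting to [near] loses
   none of them. *)
have card_type t : t \in types ->
    (\sum_(p : 'S_n | near p) (perm_type p == t))%N = 'C(n - excess t, size t).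
  move=> /typesP[sm [s ts]]; subst t; have [le_N _] := size_type s sm.
  rewrite -card_perm_type; first last.
  - exact: leq_trans le_N le_Nn.
  - exact: nontrivial_parts_neq1.
  - exact: nontrivial_parts_connected.
  rewrite -sum1_card big_mkcond [RHS]big_mkcond; apply: eq_bigr => p _.
  rewrite inE near_type; case: eqP => [->|_]; first by rewrite sm.
  by rewrite if_same.
(* For n >= N every excess is at most n, which is the range where [bin_poly] evaluates to the
   binomial coefficient. *)
rewrite big_seq (eq_bigr (fun t => ('C(n - excess t, size t))%:R)); last first.
  move=> t /typesP[sm [s ts]]; subst t; have [le_N _] := size_type s sm.
  by rewrite horner_bin_poly // (leq_trans le_N).
(* Double counting: after the exchange of sums, each permutation in the ball contributes 1, its type
   occurring exactly once in [types]. *)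
rewrite -natr_sum -(eq_bigr _ card_type) -big_seq exchange_big /=; congr (_%:R).
rewrite -sum1_card [RHS](eq_bigl near) => [|p]; last by rewrite inE.
apply: eq_bigr => p; rewrite near_type => /typesI pt.
rewrite (eq_bigr (fun t => nat_of_bool (pred1 (perm_type p) t))) => [|t _].
  by rewrite -big_mkcond /= sum1_count count_uniq_mem ?undup_uniq // pt.
by rewrite /= eq_sym.
Qed.
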